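(* For all integers $n$, \[ P_{-n}=P_{n-7}^2-P_{n-6}P_{n-8} \qquad\text{and}\qquad 2Q_{-n}=Q_n^2-Q_{2n}. \]
   Context: The Padovan numbers $P_n$ are defined for all integers $n$ by $P_0=P_1=P_2=1$ and $P_n=P_{n-2}+P_{n-3}$ for all integers $n$ (extended to negative indices via $P_n=P_{n+3}-P_{n+1}$). The Perrin numbers $Q_n$ are defined for all integers $n$ by $Q_0=3$, $Q_1=0$, $Q_2=2$ and $Q_n=Q_{n-2}+Q_{n-3}$ for all integers $n$. *)

(* Defs.v *)
From mathcomp Require Import all_boot all_order all_algebra.

Set Implicit Arguments.
Unset Strict Implicit.
Unset Printing Implicit Defensive.

Import GRing.Theory.
Local Open Scope ring_scope.

Fixpoint rec_fwd (a0 a1 a2 : int) (k : nat) {struct k} : int :=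
  match k with
  | 0%N => a0
  | 1%N => a1
  | 2%N => a2
  | (((k'.+1) as k1).+2)%N => rec_fwd a0 a1 a2 k1 + rec_fwd a0 a1 a2 k'
  end.

(* Term of index 2 - k, computed downwards by u_n = u_(n+3) - u_(n+1). *)
Fixpoint rec_bwd (a0 a1 a2 : int) (k : nat) {struct k} : int :=
  match k with
  | 0%N => a2
  | 1%N => a1
  | 2%N => a0
  | (((k'.+2) as k2).+1)%N => rec_bwd a0 a1 a2 k' - rec_bwd a0 a1 a2 k2
  end.

(* The two-sided sequence with u_0 = a0, u_1 = a1, u_2 = a2 and
   u_n = u_(n-2) + u_(n-3) for every integer n (see rec_seqE).
   Negz k is the integer -(k+1) = 2 - (k+3). *)
Definition rec_seq (a0 a1 a2 : int) (n : int) : int :=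
  match n with
  | Posz k => rec_fwd a0 a1 a2 k
  | Negz k => rec_bwd a0 a1 a2 k.+3
  end.

Definition padovan : int -> int := rec_seq 1 1 1.

Definition perrin : int -> int := rec_seq 3 0 2.

Lemma rec_seqE (a0 a1 a2 n : int) :
  rec_seq a0 a1 a2 n = rec_seq a0 a1 a2 (n - 2) + rec_seq a0 a1 a2 (n - 3).
Proof.
have bwdE k : rec_bwd a0 a1 a2 k.+3
    = rec_bwd a0 a1 a2 k - rec_bwd a0 a1 a2 k.+2 by [].
case: n => [[|[|[|k]]]|k].
- rewrite [0%:Z - 2](_ : _ = Negz 1) // [0%:Z - 3](_ : _ = Negz 2) //.
  by rewrite /rec_seq [rec_bwd _ _ _ 5]bwdE addrC subrK.
- rewrite [1%:Z - 2](_ : _ = Negz 0) // [1%:Z - 3](_ : _ = Negz 1) //.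
  by rewrite /rec_seq [rec_bwd _ _ _ 4]bwdE addrC subrK.
- rewrite [2%:Z - 2](_ : _ = Posz 0) // [2%:Z - 3](_ : _ = Negz 0) //.
  by rewrite /rec_seq [rec_bwd _ _ _ 3]bwdE addrC subrK.
- rewrite (_ : Posz k.+3 - 2 = Posz k.+1); last by rewrite -[k.+3]addn2 PoszD addrK.
  by rewrite (_ : Posz k.+3 - 3 = Posz k) //; rewrite -[k.+3]addn3 PoszD addrK.
- rewrite (_ : Negz k - 2 = Negz k.+2); last first.
    by rewrite !NegzE -opprD -PoszD addn2.
  rewrite (_ : Negz k - 3 = Negz k.+3); last first.
    by rewrite !NegzE -opprD -PoszD addn3.
  by rewrite /rec_seq [rec_bwd _ _ _ k.+3.+3]bwdE addrC subrK.
Qed.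

(* Main.v *)
(** The recurrence has characteristic polynomial x^3 - x - 1, whose roots
    a, b, c satisfy abc = 1.  If u_n = A a^n + B b^n + C c^n, then the squares
    cancel in u_n^2 - u_(n+1) u_(n-1), which is therefore a combination of
    (ab)^n = c^(-n), (ac)^n = b^(-n) and (bc)^n = a^(-n), i.e. it solves the
    reversed recurrence; three values identify it.  The Perrin number Q_n is the
    power sum a^n + b^n + c^n, so Q_n^2 - Q_(2n) is twice the second elementary
    symmetric function of a^n, b^n, c^n, and again solves the reversed
    recurrence.  To check this polynomially, Q_(2n) is expressed through
    Q_n, Q_(n+1), Q_(n+2) by inverting the Gram matrix of the trace form. *)

Require Import Defs.
From mathcomp Require Import all_boot all_order all_algebra.
From mathcomp Require Import ring zify.

Import GRing.Theory.
Local Open Scope ring_scope.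

Definition padovan_rec (u : int -> int) :=
  forall n, u (n + 3) = u (n + 1) + u n.

Lemma rec_seq_rec (a0 a1 a2 : int) : padovan_rec (rec_seq a0 a1 a2).
Proof.
move=> n; rewrite rec_seqE.
by congr (rec_seq _ _ _ _ + rec_seq _ _ _ _); ring.
Qed.

Lemma padovan_rec_inj (u v : int -> int) :
  padovan_rec u -> padovan_rec v ->
  u 0 = v 0 -> u 1 = v 1 -> u 2 = v 2 -> u =1 v.
Proof.
move=> recu recv uv0 uv1 uv2 n.
suff [] : [/\ u n = v n, u (n + 1) = v (n + 1) & u (n + 2) = v (n + 2)] by [].
elim/int_rec: n => [|n [IH0 IH1 IH2]|n [IH0 IH1 IH2]]; first by [].
- rewrite -addn1 PoszD -!addrA; split=> //.
  by rewrite recu recv IH0 IH1.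
(* Downward step: [u m] is recovered from [u (m + 3)] by cancelling [u (m + 1)]. *)
- set m := - (n.+1)%:Z.
  have nE : - n%:Z = m + 1 by rewrite /m; lia.
  move: IH0 IH1 IH2; rewrite nE -!addrA => IH0 IH1 IH2; split=> //.
  by apply: (addrI (u (m + 1))); rewrite -recu IH0 -recv.
Qed.

Lemma padovan_rec_opp (u : int -> int) :
  (forall n, u n = u (n + 2) + u (n + 3)) -> padovan_rec (fun n => u (- n)).
Proof.
move=> recu n; rewrite recu.
by congr (u _ + u _); ring.
Qed.

Lemma padovan_rec4 (u : int -> int) (n : int) :
  padovan_rec u -> u (n + 4) = u (n + 2) + u (n + 1).
Proof. by move=> recu; rewrite (_ : 4 = 1 + 3) // addrA recu -addrA. Qed.

Lemma padovan_rec5 (u : int -> int) (n : int) :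
  padovan_rec u -> u (n + 5) = u (n + 2) + u (n + 1) + u n.
Proof.
by move=> recu; rewrite (_ : 5 = 2 + 3) // addrA recu -addrA recu; ring.
Qed.

Lemma padovan_neg (n : int) :
  padovan (- n) = padovan (n - 7) ^+ 2 - padovan (n - 6) * padovan (n - 8).
Proof.
have P : padovan_rec padovan by exact: rec_seq_rec.
pose v m := padovan (m - 7) ^+ 2 - padovan (m - 6) * padovan (m - 8).
suff /(_ (- n)) -> : padovan =1 (fun m => v (- m)) by rewrite /v opprK.
apply: padovan_rec_inj => //; apply: padovan_rec_opp => m; rewrite /v.
(* Counting from m - 8 makes every offset nonnegative, so all terms reduce to three consecutive
   values. *)
have -> : m = m - 8 + 8 by rewrite subrK.
move: (m - 8) => k; rewrite -!(addrA k).
rewrite (_ : 8 - 7 = 1) // (_ : 8 - 6 = 2) // (_ : 8 - 8 = 0) // addr0.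
rewrite (_ : 8 + 2 - 7 = 3) // (_ : 8 + 2 - 6 = 4) // (_ : 8 + 2 - 8 = 2) //.
rewrite (_ : 8 + 3 - 7 = 4) // (_ : 8 + 3 - 6 = 5) // (_ : 8 + 3 - 8 = 3) //.
rewrite padovan_rec5 // padovan_rec4 // P; ring.
Qed.

(* The coefficients are those of the negated adjugate of the Gram matrix
   (Q_(i+j)) for 0 <= i, j <= 2, whose determinant is -23. *)
Lemma perrinD (m n : int) :
  23 * perrin (m + n) =
    5 * (perrin m * perrin n) - 2 * (perrin (m + 1) * perrin (n + 1))
    - 6 * (perrin (m + 2) * perrin (n + 2))
    - 6 * (perrin m * perrin (n + 1) + perrin (m + 1) * perrin n)
    + 4 * (perrin m * perrin (n + 2) + perrin (m + 2) * perrin n)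
    + 9 * (perrin (m + 1) * perrin (n + 2) + perrin (m + 2) * perrin (n + 1)).
Proof.
have P : padovan_rec perrin by exact: rec_seq_rec.
(* For fixed m, both sides solve the recurrence in n. *)
move: n; apply: padovan_rec_inj => [n|n|||].
- by rewrite !(addrA m) P mulrDr.
- rewrite -!(addrA n) (_ : 3 + 1 = 4) // (_ : 3 + 2 = 5) //
    (_ : 1 + 1 = 2) // (_ : 1 + 2 = 3) //.
  rewrite padovan_rec5 // padovan_rec4 // P; ring.
- rewrite addr0 [0 + 1]add0r [0 + 2]add0r.
  rewrite (_ : perrin 0 = 3) // (_ : perrin 1 = 0) // (_ : perrin 2 = 2) //; ring.
- rewrite (_ : perrin (1 + 1) = 2) // (_ : perrin (1 + 2) = 3) //
    (_ : perrin 1 = 0) //; ring.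
- rewrite (_ : perrin (2 + 1) = 3) // (_ : perrin (2 + 2) = 2) //
    (_ : perrin 2 = 2) //; ring.
Qed.

Lemma perrin_neg (n : int) :
  2 * perrin (- n) = perrin n ^+ 2 - perrin (2 * n).
Proof.
have P : padovan_rec perrin by exact: rec_seq_rec.
pose v m := perrin m ^+ 2 - perrin (2 * m).
suff /(_ (- n)) E : (fun m => 2 * perrin m) =1 (fun m => v (- m)).
  by rewrite E /v opprK.
apply: padovan_rec_inj => //; first by move=> m; rewrite P mulrDr.
(* The factor 23 lets [perrinD] turn each Q_(2k) into a quadratic form in Q_k, Q_(k+1), Q_(k+2). *)
apply: padovan_rec_opp => m; apply: (@mulfI _ 23) => //.
have vE k : 23 * v k = 23 * perrin k ^+ 2 - 23 * perrin (k + k).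
  by rewrite /v mulrBr mulr_natl mulr2n.
rewrite [RHS]mulrDr !vE !perrinD -!(addrA m).
rewrite (_ : 2 + 1 = 3) // (_ : 2 + 2 = 4) // (_ : 3 + 1 = 4) // (_ : 3 + 2 = 5) //.
rewrite padovan_rec5 // padovan_rec4 // P; ring.
Qed.

Theorem theorem5 (n : int) :
  padovan (- n) = padovan (n - 7) ^+ 2 - padovan (n - 6) * padovan (n - 8)
  /\ 2 * perrin (- n) = perrin n ^+ 2 - perrin (2 * n).
Proof. by split; [exact: padovan_neg | exact: perrin_neg]. Qed.
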